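(* Every locatable graph is $4$-colourable (i.e. has chromatic number at most $4$).
   Context: The robber-locating game on a finite connected simple graph $G$: a robber occupies an unknown vertex. In each round the cop probes any vertex $p$ of $G$ (no restriction), and the robber truthfully announces the graph distance from his current vertex to $p$. If the information gathered so far determines the robber's current vertex uniquely, the cop wins. Otherwise the robber moves to an adjacent vertex or stays put, with the no-backtrack condition: he may not move to the vertex $p$ just probed. The robber is omniscient. $G$ is locatable if the cop has a strategy guaranteed to determine the robber's vertex after finitely many probes, and non-locatable otherwise. *)

(* Defs.v *)
From mathcomp Require Import all_boot.

Set Implicit Arguments.
Unset Strict Implicit.
Unset Printing Implicit Defensive.

(* A finite simple graph is a finType of vertices with a symmetric
   irreflexive adjacency relation. *)
Definition connected_graph (T : finType) (e : rel T) : Prop :=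
  forall x y : T, connect e x y.

Definition colourable (T : finType) (e : rel T) (k : nat) : Prop :=
  exists f : T -> 'I_k, forall x y : T, e x y -> f x <> f y.

(* Least length of a walk from x to y. A shortest walk has fewer than #|T|
   edges, so searching the lengths below #|T| suffices; the value is #|T|
   when y is unreachable from x. *)
Definition dist (T : finType) (e : rel T) (x y : T) : nat :=
  find (fun n => [exists p : n.-tuple T, path e x p && (last x p == y)])
       (iota 0 #|T|).

(* A cop strategy gives the next probe from the list of all answers so far.
   A robber trajectory gives his vertex r n at the time of the n-th probe,
   with rounds numbered from 0. *)
Definition strategy (T : finType) : Type := seq nat -> T.

Section Game.

Variables (T : finType) (e : rel T) (s : strategy T) (r : nat -> T).

Fixpoint answers (n : nat) : seq nat :=
  if n is m.+1 then rcons (answers m) (dist e (r m) (s (answers m)))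
  else [::].

Definition probe (n : nat) : T := s (answers n).

(* If r i is itself the probed vertex then the answer 0 has already located
   the robber, so whether he may then stay put has no effect on the game. *)
Definition legal_upto (n : nat) : Prop :=
  forall i : nat, i < n ->
    r i.+1 = r i \/ (e (r i) (r i.+1) /\ r i.+1 <> probe i).

End Game.

(* After the answer of round n, every trajectory compatible with the rules and
   with all answers received ends at the actual vertex of the robber. *)
Definition located (T : finType) (e : rel T) (s : strategy T) (r : nat -> T)
    (n : nat) : Prop :=
  forall r' : nat -> T,
    legal_upto e s r' n -> answers e s r' n.+1 = answers e s r n.+1 ->
    r' n = r n.

Definition locatable (T : finType) (e : rel T) : Prop :=
  exists s : strategy T, forall r : nat -> T,
    (forall n : nat, legal_upto e s r n) -> exists n : nat, located e s r n.

(* Main.v *)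
(* A non-4-colourable graph is not 3-degenerate, so it contains a nonempty set H
   of vertices in which every vertex has at least four neighbours. The robber
   stays in H: from u he has at least four legal moves within H, even though
   the last probed vertex is forbidden, while their distances to the next probe
   differ from that of u by at most one. Hence two of these moves receive the
   same answer, and the robber is not located if he makes one of them. *)

Require Import Defs.
From mathcomp Require Import all_boot.
From mathcomp Require Import zify.

Set Implicit Arguments.
Unset Strict Implicit.
Unset Printing Implicit Defensive.

(** Greedy colouring: remove a vertex with at most [k] neighbours in the current set and colour the
    rest by induction; its neighbours leave one of the [k.+1] colours free. *)
Lemma degenerate_colouring (T : finType) (e : rel T) (k : nat) :
    symmetric e -> irreflexive e ->
    (forall H : {set T}, H != set0 ->
       exists2 u, u \in H & #|[set v in H | e u v]| <= k) ->
  colourable e k.+1.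
Proof.
move=> e_sym e_irr degen.
suff colour_on (n : nat) (A : {set T}) : #|A| <= n ->
    exists f : T -> 'I_k.+1, {in A &, forall x y, e x y -> f x <> f y}.
  have [f fP] := colour_on _ [set: T] (leqnn _).
  by exists f => x y; apply: fP; rewrite inE.
elim: n A => [|n IHn] A leAn.
  exists (fun=> ord0) => x y xA.
  by move: leAn; rewrite leqn0 cards_eq0 => /eqP A0; rewrite A0 inE in xA.
have [-> | /degen [u uA deg_u]] := eqVneq A set0.
  by exists (fun=> ord0) => x y; rewrite inE.
have [|f fP] := IHn (A :\ u); first by rewrite (cardsD1 u) uA in leAn.
pose used := f @: [set v in A | e u v].
have [c c_free] : exists c, c \notin used.
  apply/existsP; rewrite -negb_forall; apply/negP => /forallP all_used.
  have : #|'I_k.+1| <= #|used| by apply/subset_leq_card/subsetP => c _.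
  by rewrite card_ord => /leq_trans/(_ (leq_imset_card _ _)); lia.
have c_ok x : x \in A -> e u x -> f x <> c.
  move=> xA eux fx; move/negP: c_free; apply.
  by rewrite -fx; apply: imset_f; rewrite inE xA.
exists (fun x => if x == u then c else f x) => x y xA yA exy.
have [xu|xNu] := eqVneq x u; have [yu|yNu] := eqVneq y u.
- by rewrite xu yu e_irr in exy.
- by move/esym; apply: c_ok => //; rewrite -xu.
- by apply: c_ok => //; rewrite -yu e_sym.
- by apply: fP => //; rewrite !inE ?xNu ?yNu.
Qed.

Section Distance.

Variables (T : finType) (e : rel T).

Lemma dist_le_size (x : T) (p : seq T) :
  path e x p -> size p < #|T| -> dist e x (last x p) <= size p.
Proof.
move=> ep ltp; rewrite leqNgt; apply/negP => /(before_find 0).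
rewrite nth_iota // add0n /= => /existsP; apply.
by exists (in_tuple p); rewrite ep eqxx.
Qed.

(** A repetition-free path has fewer than [#|T|] edges, so the search in [dist] succeeds within its
    range. *)
Lemma dist_walk (x y : T) : connect e x y ->
  dist e x y < #|T| /\
  exists p, [/\ path e x p, last x p = y & size p = dist e x y].
Proof.
move=> /connectP[p0 /shortenP[p ep up _] lp].
have ltp : size p < #|T|.
  by have := max_card (mem (x :: p)); rewrite (card_uniqP up).
have ltd : dist e x y < #|T|.
  by rewrite lp; apply: leq_ltn_trans (dist_le_size ep ltp) ltp.
split=> //.
have := @nth_find _ 0 (fun n => [exists p : n.-tuple T, path e x p && (last x p == y)])
  (iota 0 #|T|).
rewrite has_find size_iota => /(_ ltd).
rewrite nth_iota // add0n /= => /existsP[q /andP[eq /eqP lq]].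
by exists q; rewrite size_tuple.
Qed.

Lemma dist_adj (x y z : T) : connect e y z -> connect e x z -> e x y ->
  dist e x z <= (dist e y z).+1.
Proof.
move=> /dist_walk[_ [p [ep <- sp]]] /dist_walk[ltx _] exy.
(* The walk [y :: p] may be too long for the range searched by [dist]; then the bound follows from
   [dist e x z < #|T|]. *)
have [ltp | lep] := ltnP (size p).+1 #|T|.
  by rewrite -sp; apply: (@dist_le_size x (y :: p)); rewrite //= exy.
by rewrite -sp (leq_trans _ lep) // ltnW.
Qed.

End Distance.

Section Game.

Variables (T : finType) (e : rel T) (s : strategy T).

Lemma eq_answers (r r' : nat -> T) (n : nat) :
  (forall i, i < n -> r i = r' i) -> answers e s r n = answers e s r' n.
Proof.
elim: n => //= n IHn rr'.
by rewrite rr' // IHn // => i /ltnW/rr'.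
Qed.

(** Following [r] before round [n] and then going to [b] yields the same answers. The move condition
    on [b] is vacuous for [n = 0], as the starting vertex is free. *)
Lemma not_located (r : nat -> T) (n : nat) (b : T) :
    legal_upto e s r n ->
    (forall m, n = m.+1 ->
       b = r m \/ (e (r m) b /\ b <> probe e s r m)) ->
    dist e b (probe e s r n) = dist e (r n) (probe e s r n) -> b <> r n ->
  ~ located e s r n.
Proof.
move=> r_legal b_legal b_dist b_neq.
pose r' i := if i < n then r i else b.
have ans i : i <= n -> answers e s r' i = answers e s r i.
  by move=> le_in; apply: eq_answers => j lt_ji; rewrite /r' (leq_trans lt_ji).
have r'n : r' n = b by rewrite /r' ltnn.
move=> /(_ r'); rewrite r'n => located_b; apply/b_neq/located_b; last first.
  by rewrite /= ans // r'n b_dist.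
move=> i lt_in; rewrite /probe ans 1?ltnW // {1 3}/r' lt_in /r' lt_in.
case: ltnP => [lt_i1n | le_ni1]; first exact: r_legal.
by apply: b_legal; apply/eqP; rewrite eqn_leq le_ni1 lt_in.
Qed.

End Game.

Section Evasion.

Variables (T : finType) (e : rel T) (H : {set T}).
Hypotheses (e_sym : symmetric e) (e_irr : irreflexive e).
Hypothesis e_conn : connected_graph e.
Hypothesis degH : {in H, forall u, 3 < #|[set v in H | e u v]|}.

Definition move_in (u p v : T) : bool :=
  (v \in H) && ((v == u) || (e u v && (v != p))).

Lemma move_inW u p v :
  move_in u p v -> v = u \/ (e u v /\ v <> p).
Proof. by case/andP=> _ /orP[/eqP|/andP[? /eqP]]; [left | right]. Qed.

Definition ambiguous (u p q : T) (ab : T * T) : bool :=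
  [&& move_in u p ab.1, move_in u p ab.2, ab.1 != ab.2
    & dist e ab.1 q == dist e ab.2 q].

Lemma ambiguous_moves u p q : u \in H -> exists ab, ambiguous u p q ab.
Proof.
move=> uH; apply/existsP; rewrite -[[exists _, _]]negbK negb_exists.
apply/negP => /forallP none.
pose B := [set v | move_in u p v].
have B_gt3 : 3 < #|B|.
  (* Forbidding [p] costs at most one of the four neighbours; staying at [u] makes up for it. *)
  have sub : u |: ([set v in H | e u v] :\ p) \subset B.
    apply/subsetP => v; rewrite !inE /move_in.
    by case/orP=> [/eqP->|/and3P[-> -> ->]]; rewrite ?uH ?eqxx ?orbT.
  apply: leq_trans (subset_leq_card sub).
  rewrite cardsU1 !inE e_irr !andbF /=.
  by have := degH uH; rewrite (cardsD1 p); case: (p \in _) => /=; lia.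
have near v : v \in B ->
    dist e v q <= (dist e u q).+1 /\ dist e u q <= (dist e v q).+1.
  rewrite inE => /move_inW [-> | [euv _]]; first by lia.
  by split; apply: dist_adj => //; rewrite e_sym.
(* The change in distance is -1, 0 or 1; adding one encodes it in ['I_3], and by [near] the
   subtraction never truncates on [B]. *)
pose shift v : 'I_3 := inord ((dist e v q).+1 - dist e u q).
have shift_inj : {in B &, injective shift}.
  move=> a b aB bB /(congr1 val).
  have [? ?] := near _ aB; have [? ?] := near _ bB.
  rewrite /= !inordK; try lia; move=> eq_shift.
  apply/eqP/negP => /negP ab; have /negP := none (a, b); apply.
  rewrite !inE in aB bB; rewrite /ambiguous /= aB bB ab; apply/eqP; lia.
have := max_card (mem (shift @: B)).
by rewrite card_ord (card_in_imset shift_inj) leqNgt B_gt3.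
Qed.

Definition reply (u p q : T) : T * T := odflt (u, u) [pick ab | ambiguous u p q ab].

Lemma replyP p q u : u \in H -> ambiguous u p q (reply u p q).
Proof.
move=> /(@ambiguous_moves u p q)[ab abP]; rewrite /reply.
by case: pickP => //= /(_ ab); rewrite abP.
Qed.

Arguments replyP p q {u}.

Variables (s : strategy T) (u0 : T).
Hypothesis u0H : u0 \in H.

(* The answers before round n, and the pair of ambiguous moves for round n: the
   robber makes the first one. *)
Fixpoint play (n : nat) : seq nat * (T * T) :=
  if n is m.+1 then
    let: (h, (u, _)) := play m in
    let h' := rcons h (dist e u (s h)) in (h', reply u (s h) (s h'))
  else ([::], reply u0 u0 (s [::])).

Definition robber (n : nat) : T := (play n).2.1.

Lemma answers_robber n : answers e s robber n = (play n).1.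
Proof. by elim: n => //= n ->; rewrite /robber; case: (play n) => h [a b]. Qed.

(** The next probe depends only on answers already given, so a robber who knows [s] can foresee it
    before moving. *)
Lemma play_succ n :
  (play n.+1).2 = reply (robber n) (probe e s robber n) (probe e s robber n.+1).
Proof.
by rewrite /probe !answers_robber /robber /=; case: (play n) => h [a b].
Qed.

Lemma robber_in n : robber n \in H.
Proof.
elim: n => [|n IHn].
  by have /and4P[/andP[]] := replyP u0 (s [::]) u0H.
rewrite /robber play_succ.
by have /and4P[/andP[]] := replyP (probe e s robber n) (probe e s robber n.+1) IHn.
Qed.

Lemma robber_evades :
  (forall n, legal_upto e s robber n) /\ (forall n, ~ located e s robber n).
Proof.
(* Round 0 is treated as a move from a fictitious earlier position [u0], with [u0] as the last
   probe. *)
have ambig0 : ambiguous u0 u0 (s [::]) (play 0).2 := replyP u0 (s [::]) u0H.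
have ambig n : ambiguous (robber n) (probe e s robber n)
    (probe e s robber n.+1) (play n.+1).2.
  by rewrite play_succ; apply/replyP/robber_in.
have legal n : legal_upto e s robber n.
  by move=> i _; have /and4P[/move_inW move_a _ _ _] := ambig i.
(* The move of the pair that the robber did not make is the alternative position. *)
split=> // n; apply: (@not_located _ _ _ _ _ (play n).2.2) => //.
- by move=> m ->; have /and4P[_ /move_inW move_b _ _] := ambig m.
- case: n => [|n]; first by have /and4P[_ _ _ /eqP] := ambig0.
  by have /and4P[_ _ _ /eqP] := ambig n.
- case: n => [|n] /esym; first by have /and4P[_ _ /eqP] := ambig0.
  by have /and4P[_ _ /eqP] := ambig n.
Qed.

End Evasion.

Theorem theorem4p1 (T : finType) (e : rel T) (e_sym : symmetric e)
    (e_irr : irreflexive e) (e_conn : connected_graph e) :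
  locatable e -> colourable e 4.
Proof.
move=> [s s_wins]; apply: degenerate_colouring => // H /set0Pn[u0 u0H].
apply/exists_inP; rewrite -[[exists _ in _, _]]negbK negb_exists_in.
apply/negP => /forall_inP deg.
have degH : {in H, forall u, 3 < #|[set v in H | e u v]|}.
  by move=> u /deg; rewrite -ltnNge.
have [legal evades] := robber_evades e_sym e_irr e_conn degH s u0H.
by have [n /evades] := s_wins _ legal.
Qed.
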